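(* Let $(\mathfrak{g},\omega)$ be a flat symplectic Lie algebra. Then $\mathfrak{g}$ is nilpotent and its center $Z(\mathfrak{g})$ is degenerate with respect to $\omega$, i.e. $Z(\mathfrak{g})\cap Z(\mathfrak{g})^\perp\neq\{0\}$.
   Context: A symplectic Lie algebra $(\mathfrak{g},\omega)$ is a finite-dimensional real Lie algebra $\mathfrak{g}$ with a non-degenerate skew-symmetric bilinear form $\omega$ such that $\omega([u,v],w)+\omega([v,w],u)+\omega([w,u],v)=0$ for all $u,v,w\in\mathfrak{g}$. Its associated product $\bullet$ is the bilinear product on $\mathfrak{g}$ defined by $\omega(u\bullet v,w)=\frac13\big(\omega([u,v],w)+\omega([u,w],v)\big)$ for all $u,v,w$; put $\mathrm{L}_u v=u\bullet v$. $(\mathfrak{g},\omega)$ is called flat if $\mathrm{L}_{[u,v]}=\mathrm{L}_u\mathrm{L}_v-\mathrm{L}_v\mathrm{L}_u$ for all $u,v\in\mathfrak{g}$. For a subspace $F$, $F^\perp=\{x\in\mathfrak{g}: \omega(x,y)=0\ \forall y\in F\}$; $F$ is degenerate if $F\cap F^\perp\neq\{0\}$.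
   Formalization: Degeneracy of the center is asserted only for non-abelian Lie algebras: an abelian symplectic Lie algebra is flat with Z(g) = g and Z(g)^⊥ = 0, so the claim fails there; nilpotency is proved without this restriction. *)

(* Defs.v *)
From HB Require Import structures.
From mathcomp Require Import all_boot all_order all_algebra.
From mathcomp Require Import all_classical all_reals.

Set Implicit Arguments.
Unset Strict Implicit.
Unset Printing Implicit Defensive.

Import Order.TTheory GRing.Theory Num.Theory.
Local Open Scope ring_scope.

HB.mixin Record Vector_isLieAlgebra (F : fieldType) (g : Type)
    of Vector F g := {
  lie : {bilinear g -> g -> g};
  lie_alt : forall x : g, lie x x = 0;
  lie_jacobi : forall x y z : g,
    lie x (lie y z) + lie y (lie z x) + lie z (lie x y) = 0
}.

#[short(type="lieAlgType")]
HB.structure Definition LieAlgebra (F : fieldType) :=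
  {g of Vector F g & Vector_isLieAlgebra F g}.

Section LieTheory.
Variables (F : fieldType) (g : lieAlgType F).
Implicit Types (x y u v w : g) (U V W : {vspace g}).

Lemma lieC x y : lie x y = - lie y x.
Proof.
apply/eqP; rewrite -addr_eq0; apply/eqP.
have := lie_alt (x + y).
by rewrite linearDl /= !linearDr /= !lie_alt add0r addr0.
Qed.

Definition lie_abelian : Prop := forall x y, lie x y = 0.

Definition lie_center : {vspace g} :=
  (\bigcap_(i < \dim {:g}) lker (linfun (applyr lie (vbasis {:g})`_i)))%VS.

Lemma lie_centerP x : reflect (forall y, lie x y = 0) (x \in lie_center).
Proof.
rewrite memvE; apply: (iffP subv_bigcapP) => [xZ y|xZ i _]; last first.
  by rewrite -memvE memv_ker lfunE /= xZ.
rewrite (coord_vbasis (memvf y)) linear_sumr big1 // => i _.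
have := xZ i isT; rewrite -memvE memv_ker lfunE /= => /eqP xi0.
by rewrite linearZr_LR /= xi0 scaler0.
Qed.

(* The span of all brackets [u, v] with u in U and v in V; by bilinearity it
   suffices to bracket bases, see lie_prodvP. *)
Definition lie_prodv U V : {vspace g} :=
  <<[seq lie u v | u <- vbasis U, v <- vbasis V]>>%VS.

Lemma memv_lie U V u v : u \in U -> v \in V -> lie u v \in lie_prodv U V.
Proof.
move=> /coord_vbasis-> /coord_vbasis->.
rewrite linear_sumlz memv_suml // => i _.
rewrite linear_sumr memv_suml // => j _.
rewrite linearZl_LR linearZr_LR /= !memvZ // memv_span //.
by apply/allpairsP; exists ((vbasis U)`_i, (vbasis V)`_j);
  rewrite !mem_nth ?size_tuple.
Qed.

Lemma lie_prodvP U V W :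
  reflect {in U & V, forall u v, lie u v \in W} (lie_prodv U V <= W)%VS.
Proof.
apply: (iffP idP) => [sUVW u v uU vV|UVW].
  exact: (subvP sUVW _ (memv_lie uU vV)).
apply/span_subvP => _ /allpairsP[[u v] /= [uU vV ->]].
by apply: UVW; apply: vbasis_mem.
Qed.

Fixpoint lower_central_series (n : nat) : {vspace g} :=
  if n is m.+1 then lie_prodv fullv (lower_central_series m) else fullv.

Definition lie_nilpotent : Prop :=
  exists n, lower_central_series n = 0%VS.

End LieTheory.

Arguments lie_abelian {F} g.
Arguments lie_center {F} g.
Arguments lie_nilpotent {F} g.

Section Symplectic.
Variables (F : fieldType) (g : lieAlgType F) (omega : {skew_symmetric g}).
Implicit Types (u v w x : g) (U : {vspace g}).

Definition lie_symplectic : Prop :=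
  nondegenerate omega /\
  forall u v w,
    omega (lie u v) w + omega (lie v w) u + omega (lie w u) v = 0.

Definition degenerate_subspace U : bool := (U :&: orthov omega U != 0)%VS.

(* The vector u . v characterised by
   omega (u . v) w = 1/3 (omega [u, v] w + omega [u, w] v) for all w;
   existence and uniqueness for nondegenerate omega are assoc_prodE and
   assoc_prod_unique. The default value 0 of xget is then irrelevant. *)
Definition assoc_prod u v : g :=
  xget 0 [set x | forall w,
    omega x w = 3%:R^-1 * (omega (lie u v) w + omega (lie u w) v)].

Definition left_mul u : g -> g := assoc_prod u.

Definition lie_flat : Prop := forall u v,
  left_mul (lie u v) =1
  (left_mul u \o left_mul v) \- (left_mul v \o left_mul u).

Hypothesis omega_nd : nondegenerate omega.

Lemma nondegenerate_inj x y : (forall w, omega x w = omega y w) -> x = y.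
Proof.
move=> xy; apply/eqP; rewrite -subr_eq0 -memv0 -(eqP omega_nd).
by apply/mem_orthovP => w _; rewrite linearBl /= xy subrr.
Qed.

Lemma riesz_exists (f : {linear g -> F^o}) : exists x, forall w, omega x w = f w.
Proof.
pose n := \dim {:g}; pose e := vbasis {:g}.
pose phi x : 'rV[F]_n := \row_i omega x e`_i.
have phi_lin : linear phi.
  by move=> a x y; apply/rowP => i; rewrite !mxE linearPl.
pose L : {linear g -> 'rV[F]_n} :=
  HB.pack phi (GRing.isLinear.Build _ _ _ _ phi phi_lin).
have expand x w : omega x w = \sum_(i < n) coord e i w * omega x e`_i.
  rewrite {1}(coord_vbasis (memvf w)) linear_sumr; apply: eq_bigr => i _.
  by rewrite linearZr_LR.
have kerL : lker (linfun L) == 0%VS.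
  apply/lker0P => x y; rewrite !lfunE /= => /rowP xy.
  apply: nondegenerate_inj => w; rewrite !expand; apply: eq_bigr => i _.
  by have := xy i; rewrite !mxE => ->.
have imgL : limg (linfun L) = fullv.
  apply/eqP; rewrite eqEdim subvf limg_dim_eq ?(eqP kerL) ?capv0 //.
  by rewrite !dimvf /dim /= mul1n /n dimvf.
pose r : 'rV[F]_n := \row_i f e`_i.
have /memv_imgP[x _ xE] : r \in limg (linfun L) by rewrite imgL; apply: memvf.
exists x => w; rewrite expand {2}(coord_vbasis (memvf w)) linear_sum.
apply: eq_bigr => i _; rewrite linearZ_LR; congr (_ * _).
by have /rowP/(_ i) := xE; rewrite lfunE /= !mxE => <-.
Qed.

Lemma assoc_prodE u v w :
  omega (assoc_prod u v) w =
    3%:R^-1 * (omega (lie u v) w + omega (lie u w) v).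
Proof.
pose f w : F^o := 3%:R^-1 * (omega (lie u v) w + omega (lie u w) v).
have f_lin : linear f.
  move=> a x y; rewrite /f !linearPr /= linearPl /= /GRing.scale /=.
  by rewrite !mulrDr !(mulrCA _ a) !addrA; congr (_ + _); rewrite addrAC.
pose fL : {linear g -> F^o} :=
  HB.pack f (GRing.isLinear.Build _ _ _ _ f f_lin).
have [x xE] := riesz_exists fL.
exact: (@xgetPex _ 0 [set z | forall w, omega z w = f w] (ex_intro _ x xE) w).
Qed.

Lemma assoc_prod_unique u v x :
  (forall w, omega x w = 3%:R^-1 * (omega (lie u v) w + omega (lie u w) v)) ->
  x = assoc_prod u v.
Proof. by move=> xE; apply: nondegenerate_inj => w; rewrite xE assoc_prodE. Qed.

Lemma assoc_prod_bilinear : bilinear_for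
  (GRing.Scale.Law.clone _ _ *:%R _) (GRing.Scale.Law.clone _ _ *:%R _)
  assoc_prod.
Proof.
have mulrDD (c a p q p' q' : F) :
    c * ((a * p + q) + (a * p' + q')) = a * (c * (p + p')) + c * (q + q').
  by rewrite addrACA -[X in _ * (X + _)]mulrDr [LHS]mulrDr mulrCA.
split=> [v|u] a x y; apply: nondegenerate_inj => w /=.
  rewrite assoc_prodE !linearPl /= !assoc_prodE; exact: mulrDD.
rewrite [RHS]linearPl !assoc_prodE linearPr linearPl /= [omega _ (_ + _)]linearPr.
by rewrite !assoc_prodE; exact: mulrDD.
Qed.

(* An abelian g (in particular g = 0) is flat, with nondegenerate center g, so
   degeneracy of the center can only be asserted for non-abelian g. *)
Lemma abelian_flat : lie_abelian g -> lie_flat.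
Proof.
move=> ab; have p0 u v : assoc_prod u v = 0.
  by apply: nondegenerate_inj => w; rewrite assoc_prodE !ab !linear0l addr0 mulr0.
by move=> u v w; rewrite /= /left_mul !p0 subrr.
Qed.

Lemma abelian_center_nondegenerate :
  lie_abelian g -> ~~ degenerate_subspace (lie_center g).
Proof.
move=> ab; have -> : lie_center g = fullv.
  by apply/eqP; rewrite eqEsubv subvf; apply/subvP => x _; apply/lie_centerP.
by rewrite /degenerate_subspace negbK (eqP omega_nd) capv0.
Qed.

End Symplectic.

(* Main.v *)
Require Import Defs.
From HB Require Import structures.
From mathcomp Require Import all_boot all_order all_algebra all_reals.
From mathcomp Require Import lra.

(* Write xy for the associated product and {x, y} = xy + yx. It is torsion-free
   (xy - yx = [x, y]), so flatness makes it left-symmetric. Left multiplications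
   lie in sp(omega), and omega (xv) t = omega x {v, t}; taking omega-adjoints of
   left-symmetry gives the second identity
     {z, {x, y}} = (xz)y + (yz)x.
   These two identities alone force nilpotency. In degree 4 they imply
   (u{v, w})z = 0. Let K be the left ideal of all t with tV = 0. Modulo K,
   u(v(wx)) is antisymmetric in w, x, and symmetric in v, w, hence 0; so 4-fold
   brackets lie in K. On K the left multiplications commute and (vu)t = u(vt),
   hence 0 = (w{u, v})t = 2 u(v(wt)): bracketing three more times gives 0.
   For the center, the last nonzero term of the lower central series is central
   and contained in [g, g], which is orthogonal to Z(g). *)

Set Implicit Arguments.
Unset Strict Implicit.
Unset Printing Implicit Defensive.

Import Order.TTheory GRing.Theory Num.Theory.
Local Open Scope ring_scope.

(** Coordinates are scalar forms. Testing against all forms turns vector identities into scalar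
    equations that [lra] can combine. *)
Lemma scalar_eq0 (K : fieldType) (V : vectType K) (x : V) :
  (forall f : {scalar V}, f x = 0) -> x = 0.
Proof.
move=> f0; rewrite (coord_vbasis (memvf x)) big1 // => i _.
by rewrite f0 scale0r.
Qed.

(** * Consequences of left-symmetry and the second identity *)

Section LeftSymmetric.
Variables (R : realFieldType) (V : vectType R) (mul : {bilinear V -> V -> V}).
Local Notation "x ∙ y" := (mul x y) (at level 40, left associativity).

Hypothesis lsa : forall x y z,
  (x ∙ y) ∙ z - x ∙ (y ∙ z) = (y ∙ x) ∙ z - y ∙ (x ∙ z).
Hypothesis jid : forall x y z,
  (x ∙ z) ∙ y + (y ∙ z) ∙ x = z ∙ (x ∙ y + y ∙ x) + (x ∙ y + y ∙ x) ∙ z.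

Section Forms.
Variable f : {scalar V}.

Lemma lsa_form x y z :
  f (x ∙ y ∙ z) - f (x ∙ (y ∙ z)) = f (y ∙ x ∙ z) - f (y ∙ (x ∙ z)) :> R.
Proof. by have := congr1 f (lsa x y z); rewrite !linearB. Qed.

Lemma lsa_forml x y z t :
  f (t ∙ (x ∙ y ∙ z)) - f (t ∙ (x ∙ (y ∙ z))) =
  f (t ∙ (y ∙ x ∙ z)) - f (t ∙ (y ∙ (x ∙ z))) :> R.
Proof. by have := congr1 (fun v => f (t ∙ v)) (lsa x y z); rewrite !linearB. Qed.

Lemma lsa_formr x y z t :
  f (x ∙ y ∙ z ∙ t) - f (x ∙ (y ∙ z) ∙ t) =
  f (y ∙ x ∙ z ∙ t) - f (y ∙ (x ∙ z) ∙ t) :> R.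
Proof.
by have := congr1 (fun v => f (v ∙ t)) (lsa x y z); rewrite !linearBl !linearB.
Qed.

Lemma jid_form x z y :
  f (x ∙ z ∙ y) + f (y ∙ z ∙ x) =
  f (z ∙ (x ∙ y)) + f (z ∙ (y ∙ x)) + (f (x ∙ y ∙ z) + f (y ∙ x ∙ z)) :> R.
Proof. by have := congr1 f (jid x y z); rewrite !(linearDl, linearD). Qed.

Lemma jid_forml x z y t :
  f (t ∙ (x ∙ z ∙ y)) + f (t ∙ (y ∙ z ∙ x)) =
  f (t ∙ (z ∙ (x ∙ y))) + f (t ∙ (z ∙ (y ∙ x)))
  + (f (t ∙ (x ∙ y ∙ z)) + f (t ∙ (y ∙ x ∙ z))) :> R.
Proof.
by have := congr1 (fun v => f (t ∙ v)) (jid x y z); rewrite !(linearDl, linearD).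
Qed.

Lemma jid_formr x z y t :
  f (x ∙ z ∙ y ∙ t) + f (y ∙ z ∙ x ∙ t) =
  f (z ∙ (x ∙ y) ∙ t) + f (z ∙ (y ∙ x) ∙ t)
  + (f (x ∙ y ∙ z ∙ t) + f (y ∙ x ∙ z ∙ t)) :> R.
Proof.
by have := congr1 (fun v => f (v ∙ t)) (jid x y z); rewrite !(linearDl, linearD).
Qed.

(* The claim is a linear combination of the instances below; they were found by
   linear algebra on the multidegree (u, w, w, z) part of the free algebra. *)
Lemma mul_sq_form u w z : f (u ∙ (w ∙ w) ∙ z) = 0 :> R.
Proof.
move: (jid_form (u ∙ w) w z) (jid_form (u ∙ z) w w) (jid_form (w ∙ u) w z)
      (jid_form (w ∙ w) u z) (jid_form u (w ∙ w) z) (jid_form u (w ∙ z) w)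
      (jid_form u (z ∙ w) w) (jid_form u w (w ∙ z)) (jid_form w (u ∙ w) z)
      (jid_form w (u ∙ z) w) (jid_form w (w ∙ u) z) (jid_form w (z ∙ u) w)
      (jid_form w u (w ∙ z)) (jid_form w u (z ∙ w)) (jid_form w w (z ∙ u))
      (jid_formr u w w z) (jid_formr u w z w) (jid_formr u z w w)
      (jid_formr w u w z) (jid_formr w u z w) (jid_formr w z w u)
      (jid_forml u w z w) (jid_forml u z w w) (jid_forml w u z w)
      (jid_forml w w z u) (jid_forml w z w u) (lsa_form (u ∙ w) w z)
      (lsa_form (u ∙ z) w w) (lsa_form (w ∙ u) w z) (lsa_form u (w ∙ w) z)
      (lsa_form u (z ∙ w) w) (lsa_form u w (z ∙ w)) (lsa_form w (w ∙ z) u)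
      (lsa_form w (z ∙ u) w) (lsa_form w (z ∙ w) u) (lsa_formr u w w z)
      (lsa_formr u w z w) (lsa_formr u z w w) (lsa_formr w z u w)
      (lsa_formr w z w u) (lsa_forml u z w w) (lsa_forml w z u w)
      (lsa_forml w z w u).
lra.
Qed.

End Forms.

(** Polarization of [mul_sq_form] at [v + w]. *)
Lemma mul_sym_mul u v w z : u ∙ (v ∙ w + w ∙ v) ∙ z = 0.
Proof.
apply: scalar_eq0 => f; move: (mul_sq_form f u (v + w) z).
rewrite !(linearDl, linearD) /= !mul_sq_form; lra.
Qed.

Definition left_null t := forall z, t ∙ z = 0.

Lemma left_null_mul u t : left_null t -> left_null (u ∙ t).
Proof.
move=> t0 z; move/eqP: (lsa u t z).
by rewrite !t0 linear0 linear0l !subr0 => /eqP.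
Qed.

Lemma left_nullB s t : left_null s -> left_null t -> left_null (s - t).
Proof. by move=> s0 t0 z; rewrite linearBl /= s0 t0 subrr. Qed.

Lemma left_null_mul4 w v u x :
  left_null (w ∙ (v ∙ (u ∙ x))) /\ left_null (w ∙ (v ∙ u ∙ x)).
Proof.
(* Behind [w], [a ∙ b ∙ c] is [- a ∙ (b ∙ c)] modulo left-null elements: [jid] makes
   [a ∙ b ∙ c + c ∙ b ∙ a] a symmetrized product, killed by [mul_sym_mul]. *)
have switch a b c z (f : {scalar V}) :
    f (w ∙ (a ∙ b ∙ c) ∙ z) + f (w ∙ (a ∙ (b ∙ c)) ∙ z) = 0 :> R.
  have E1 : w ∙ (a ∙ b ∙ c + c ∙ b ∙ a) ∙ z = 0.
    by rewrite jid mul_sym_mul.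
  have E2 := mul_sym_mul w a (c ∙ b) z.
  have E3 : w ∙ (a ∙ (b ∙ c + c ∙ b)) ∙ z = 0.
    by apply: left_null_mul => y; exact: mul_sym_mul.
  move: (congr1 f E1) (congr1 f E2) (congr1 f E3).
  rewrite !(linearDl, linearD) /= linear0; lra.
have antisym a b c z (f : {scalar V}) :
    f (w ∙ (a ∙ (b ∙ c)) ∙ z) + f (w ∙ (a ∙ (c ∙ b)) ∙ z) = 0 :> R.
  have E3 : w ∙ (a ∙ (b ∙ c + c ∙ b)) ∙ z = 0.
    by apply: left_null_mul => y; exact: mul_sym_mul.
  by move: (congr1 f E3); rewrite !(linearDl, linearD) /= linear0.
have sym a b c z (f : {scalar V}) :
    f (w ∙ (a ∙ (b ∙ c)) ∙ z) = f (w ∙ (b ∙ (a ∙ c)) ∙ z) :> R.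
  have := congr1 (fun y => f (w ∙ y ∙ z)) (lsa a b c).
  rewrite !(linearBl, linearB) /=.
  move: (switch a b c z f) (switch b a c z f); lra.
have null a b c z (f : {scalar V}) : f (w ∙ (a ∙ (b ∙ c)) ∙ z) = 0 :> R.
  (* Six alternating swaps return to the order [a], [b], [c] with three sign changes. *)
  move: (antisym a b c z f) (sym a c b z f) (antisym c a b z f)
        (sym c b a z f) (antisym b c a z f) (sym a b c z f); lra.
split=> z; apply: scalar_eq0 => f; first exact: null.
by move: (switch v u x z f); rewrite null addr0.
Qed.

Lemma comm_mul x y z : (x ∙ y - y ∙ x) ∙ z = x ∙ (y ∙ z) - y ∙ (x ∙ z).
Proof.
apply/subr0_eq/scalar_eq0 => f; rewrite !linearBl !linearB /=.
move: (lsa_form f x y z); lra.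
Qed.

(** Every other term of [jid v t u] has [t] or [v ∙ t] as a left factor, and both are left-null. *)
Lemma mul_left_null v u t : left_null t -> v ∙ u ∙ t = u ∙ (v ∙ t).
Proof.
move=> t0; have := jid v t u.
by rewrite !t0 linear0l !addr0 (left_null_mul v t0) addr0.
Qed.

Lemma mul3_left_null u v w t : left_null t -> u ∙ (v ∙ (w ∙ t)) = 0.
Proof.
move=> t0; have s0 := left_null_mul w t0.
have mulE a b : w ∙ (a ∙ b) ∙ t = b ∙ (a ∙ (w ∙ t)).
  by rewrite !mul_left_null.
(* By [sym], left multiplications by [u] and [v] anticommute on [w ∙ t]; by [comm] they commute
   there. *)
have := mul_sym_mul w v u t; rewrite linearD linearDl /= !mulE => sym.
have := lsa u v (w ∙ t); rewrite !(mul_left_null _ _ s0) => comm.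
apply: scalar_eq0 => f; move: (congr1 f sym) (congr1 f comm).
rewrite !linearB linearD /= linear0; lra.
Qed.

Let comm x y := x ∙ y - y ∙ x.

Lemma left_null_comm4 w v u x : left_null (comm w (comm v (comm u x))).
Proof.
have null a b c : left_null (w ∙ comm a (b ∙ c)).
  rewrite /comm linearBr /=; apply: left_nullB.
    exact: (left_null_mul4 _ _ _ _).1.
  exact: (left_null_mul4 _ _ _ _).2.
apply: left_nullB.
  have -> : comm v (comm u x) = comm v (u ∙ x) - comm v (x ∙ u).
    by rewrite /comm linearBl linearBr /= opprD addrACA -opprD.
  by rewrite linearBr; apply: left_nullB.
(* Left multiplication by a commutator is a commutator of left multiplications, so only products
   [a ∙ (b ∙ (c ∙ d))] remain. *)
rewrite {1}/comm comm_mul /comm !comm_mul linearB /=.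
by apply: left_nullB; apply: left_nullB; exact: (left_null_mul4 _ _ _ _).1.
Qed.

End LeftSymmetric.

(** * The associated product of a flat symplectic Lie algebra *)

Section FlatSymplectic.
Variables (R : realFieldType) (g : lieAlgType R) (omega : {skew_symmetric g}).
Hypothesis omega_symplectic : lie_symplectic omega.

Let omega_nd : nondegenerate omega := omega_symplectic.1.

Lemma omegaC x y : omega x y = - omega y x.
Proof. by rewrite hermC /= expr1 mulN1r. Qed.

Variable prod : {bilinear g -> g -> g}.
Hypothesis prodE : prod =2 assoc_prod omega.
Local Notation "x ∙ y" := (prod x y) (at level 40, left associativity).

Lemma prod_symplectic u v w : omega (u ∙ v) w = - omega v (u ∙ w).
Proof. by rewrite (omegaC v) opprK !prodE !(assoc_prodE omega_nd) addrC. Qed.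

(** Closedness turns [omega (lie u w) v - omega (lie v w) u] into a third copy of
    [omega (lie u v) w], which cancels the factor 1/3. *)
Lemma prod_torsion_free u v : u ∙ v - v ∙ u = lie u v.
Proof.
apply: (nondegenerate_inj omega_nd) => w.
rewrite linearBl /= !prodE !(assoc_prodE omega_nd) (lieC v u) linearNl /=.
have := omega_symplectic.2 u v w; rewrite (lieC w u) linearNl /=; lra.
Qed.

Lemma prod_adjoint x v t : omega (x ∙ v) t = omega x (v ∙ t + t ∙ v).
Proof.
rewrite omegaC (omegaC x) linearDl /= !prodE !(assoc_prodE omega_nd).
rewrite (omegaC t) ?assoc_prodE // (lieC v x) (lieC t v) (lieC t x) !linearNl /=.
lra.
Qed.

Hypothesis omega_flat : lie_flat omega.

Lemma flat_lsa x y z : x ∙ y ∙ z - x ∙ (y ∙ z) = y ∙ x ∙ z - y ∙ (x ∙ z).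
Proof.
have /eqP : (x ∙ y - y ∙ x) ∙ z = x ∙ (y ∙ z) - y ∙ (x ∙ z).
  by rewrite prod_torsion_free !prodE; exact: omega_flat.
rewrite linearBl subr_eq => /eqP ->.
by rewrite addrAC [x ∙ _ - _]addrC addrK addrC.
Qed.

Lemma flat_jid x y z :
  x ∙ z ∙ y + y ∙ z ∙ x = z ∙ (x ∙ y + y ∙ x) + (x ∙ y + y ∙ x) ∙ z.
Proof.
apply: (nondegenerate_inj omega_nd) => s; rewrite 2![omega _ s]omegaC.
congr (- _).
(* Taking adjoints in this pairing with [x] isolates [s] in every term and leaves an identity in
   [x], [y], [z]. *)
have : omega (z ∙ s ∙ y - z ∙ (s ∙ y)) x = omega (s ∙ z ∙ y - s ∙ (z ∙ y)) x.
  by rewrite flat_lsa.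
rewrite !linearBl /= !(prod_adjoint _ y) !(prod_adjoint s) !(prod_symplectic z).
rewrite !(prod_adjoint s).
move: (congr1 (omega s) (flat_lsa z x y)) (congr1 (omega s) (flat_lsa z y x)).
rewrite !(linearBr, linearBl, linearDr, linearDl) /=.
lra.
Qed.

Lemma flat_lie_null (u v w a b c d : g) :
  lie u (lie v (lie w (lie a (lie b (lie c d))))) = 0 :> g.
Proof.
have t0 := left_null_comm4 flat_lsa flat_jid a b c d.
rewrite !prod_torsion_free in t0.
set t := lie a _ in t0 *.
have lieE x s : left_null prod s -> lie x s = x ∙ s.
  by move=> s0; rewrite -prod_torsion_free s0 subr0.
have n1 := left_null_mul flat_lsa w t0.
rewrite (lieE w t) // (lieE v) // lieE; last exact: left_null_mul flat_lsa _ _ n1.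
exact: mul3_left_null flat_lsa flat_jid _ _ _ _ t0.
Qed.

End FlatSymplectic.

(** * Lower central series and center *)

Section Nilpotent.
Variables (F : fieldType) (g : lieAlgType F).

(** The induction needs arbitrary [f], since its step composes [f] with [lie u]. Taking [f] to be
    the identity reduces nilpotency to the vanishing of right-normed brackets. *)
Lemma lcs_sub_lker n (W : vectType F) (f : 'Hom(g, W)) :
  (forall us x, size us = n -> f (foldr (fun u y => lie u y) x us) = 0) ->
  (lower_central_series g n <= lker f)%VS.
Proof.
elim: n W f => [|n IHn] W f f0.
  by apply/subvP => x _; rewrite memv_ker (f0 [::]).
apply/lie_prodvP => u y _ yn; rewrite memv_ker.
have /subvP/(_ y yn) : (lower_central_series g n <= lker (f \o linfun (lie u)))%VS.
  by apply: IHn => us x us_n; rewrite comp_lfunE lfunE (f0 (u :: us)) //= us_n.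
by rewrite memv_ker comp_lfunE lfunE.
Qed.

End Nilpotent.

Lemma nilpotent_center_degenerate (F : fieldType) (g : lieAlgType F)
    (omega : {skew_symmetric g}) :
  lie_symplectic omega -> lie_nilpotent g -> ~ lie_abelian g ->
  degenerate_subspace omega (lie_center g).
Proof.
move=> [nd closed] [n0 n0P] nab.
have exn : exists n, lower_central_series g n == 0%VS.
  by exists n0; apply/eqP.
(* A least index 0 or 1 makes [g] abelian. Otherwise the last nonzero term has index [m.+1], so it
   consists of brackets. *)
case: (ex_minnP exn) => -[|[|m]] /eqP n_eq0 n_min.
- by case: nab => x y; apply/eqP; rewrite -memv0 -n_eq0 memvf.
- by case: nab => x y; apply/eqP; rewrite -memv0 -n_eq0 memv_lie ?memvf.
have : (lower_central_series g m.+1 != 0)%VS.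
  by apply: contraTneq (ltnSn m.+1) => /eqP /n_min; rewrite -leqNgt.
apply: contraNneq => cap0; rewrite -subv0 -cap0 subv_cap; apply/andP; split.
  apply/subvP => y ym; apply/lie_centerP => x; rewrite lieC.
  apply/eqP; rewrite oppr_eq0 -memv0 -n_eq0; exact: memv_lie (memvf x) ym.
apply/lie_prodvP => u v _ _; apply/mem_orthovP => z /lie_centerP zZ.
have := closed u v z.
by rewrite (lieC v z) !zZ oppr0 !linear0l !addr0.
Qed.

Theorem theorem4p1 (R : realType) (g : lieAlgType R)
    (omega : {skew_symmetric g}%R)
    (omega_symplectic : lie_symplectic omega)
    (omega_flat : lie_flat omega) :
  lie_nilpotent g /\
  (~ lie_abelian g -> degenerate_subspace omega (lie_center g)).
Proof.
pose prod : {bilinear g -> g -> g} := HB.pack (assoc_prod omega)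
  (bilinear_isBilinear.Build R g g g _ _ (assoc_prod omega)
    (assoc_prod_bilinear omega_symplectic.1)).
have prodE : prod =2 assoc_prod omega by [].
suff nil : lie_nilpotent g.
  by split=> // nab; exact: nilpotent_center_degenerate.
(* Three brackets reach a left-null element and three more annihilate it. *)
exists 6; apply/eqP; rewrite -subv0 -(eqP (_ : lker \1%VF == 0%VS :> {vspace g})).
  apply: lcs_sub_lker => us x us6; rewrite lfunE /=.
  case: us us6 => [|u [|v [|w [|a [|b [|c [|d us]]]]]]] //= _.
  exact: (flat_lie_null omega_symplectic prodE omega_flat).
by apply/lker0P => x y; rewrite !lfunE.
Qed.
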